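(* Let $\gamma\in(0,\infty)$ be a finite risk aversion and let $\theta>0$ be such that there is at least one $\mathbf a$ with $(\theta,\mathbf a)\in\mathcal D$. The optimal mean-variance portfolios in the nominal and in the alternative (worst-case) model are equal, i.e. $\mathbf a^\star(\theta)=\mathbf a^\star_{\mathrm{nom}}$, if and only if $\boldsymbol\mu=\mu\,\mathbf 1$ for some $\mu\in\mathbb R$.
   Context: Let $n\ge1$, $\boldsymbol\mu\in\mathbb R^n$, $\Sigma\in\mathbb R^{n\times n}$ symmetric positive definite, and let $\mathbf X\sim N(\boldsymbol\mu,\Sigma)$ under the nominal model, with expectation $\mathbb E$. Let $\mathbf 1\in\mathbb R^n$ be the all-ones vector and $\mathcal A=\{\mathbf a\in\mathbb R^n:\mathbf a^T\mathbf 1=1\}$ the set of portfolios. Mean-variance measure of risk: $V_{\mathbf a}(\mathbf X)=\frac\gamma2\,\mathbf a^T(\mathbf X-\boldsymbol\mu)(\mathbf X-\boldsymbol\mu)^T\mathbf a-\mathbf a^T\mathbf X$. Domain: $\mathcal D=\{(\theta,\mathbf a):\theta>0,\ \mathbf a\in\mathcal A,\ \theta\,\mathbf a^T\Sigma\,\mathbf a<1/\gamma\}$. Optimal nominal portfolio: $\mathbf a^\star_{\mathrm{nom}}$ is the unique minimiser over $\mathbf a\in\mathcal A$ of $\mathbb E[V_{\mathbf a}(\mathbf X)]=\frac\gamma2\mathbf a^T\Sigma\,\mathbf a-\mathbf a^T\boldsymbol\mu$. Optimal worst-case portfolio: $\mathbf a^\star(\theta)$ is the unique minimiser of $\frac1\theta\ln\mathbb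 E[\exp(\theta V_{\mathbf a}(\mathbf X))]$ over $\{\mathbf a:(\theta,\mathbf a)\in\mathcal D\}$. *)

(* Defs.v *)
From HB Require Import structures.
From mathcomp Require Import all_boot all_order all_algebra.
From mathcomp Require Import all_classical all_reals all_analysis.
Import Order.TTheory GRing.Theory Num.Theory.
Import numFieldNormedType.Exports.

Set Implicit Arguments.
Unset Strict Implicit.
Unset Printing Implicit Defensive.

Local Open Scope classical_set_scope.
Local Open Scope ring_scope.

Section linear_algebra.
Context {R : realType} {n : nat}.

Definition ones : 'cV[R]_n := const_mx 1.

Definition dot (x y : 'cV[R]_n) : R := (x^T *m y) 0 0.

Definition quad_form (S : 'M[R]_n) (x : 'cV[R]_n) : R := (x^T *m S *m x) 0 0.

Definition posdef_sym (S : 'M[R]_n) : Prop :=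
  S^T = S /\ forall x : 'cV[R]_n, x != 0 -> 0 < quad_form S x.

End linear_algebra.

(* The normal law on the line with mean m and *variance* v (normal_prob takes
   the standard deviation).  The case v = 0 is separate because normal_prob m 0
   is by convention a uniform law, not the point mass at m. *)
Definition normal_law {R : realType} (m v : R) : set R -> \bar R :=
  if v == 0 then \d_m else normal_prob m (Num.sqrt v).

Section gaussian_vector.
Context {d : measure_display} {T : measurableType d} {R : realType}.
Context {P : probability T R} {n : nat}.

Definition vec_of (X : 'I_n -> {RV P >-> R}) (w : T) : 'cV[R]_n :=
  \col_i X i w.

(* X ~ N(mu, S): every linear combination a^T X has the univariate normal law
   with mean a^T mu and variance a^T S a. *)
Definition gaussian_vector (mu : 'cV[R]_n) (S : 'M[R]_n)
    (X : 'I_n -> {RV P >-> R}) : Prop :=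
  forall (a : 'cV[R]_n) (A : set R), measurable A ->
    pushforward P (fun w => dot a (vec_of X w)) A
    = normal_law (dot a mu) (quad_form S a) A.

End gaussian_vector.

Section optimisation.
Context {R : realType} {U : choiceType}.

Definition minimiser (C : set U) (f : U -> \bar R) (a : U) : Prop :=
  C a /\ forall b, C b -> (f a <= f b)%E.

(* The unique minimiser of f over C; the value u0 is only returned when there
   is no minimiser or more than one. *)
Definition argmin (u0 : U) (C : set U) (f : U -> \bar R) : U :=
  xget u0 [set a | unique (minimiser C f) a].

End optimisation.

Section portfolios.
Context {R : realType} {n : nat}.

Definition portfolios : set 'cV[R]_n := [set a | dot a ones = 1].

Definition mv_risk (gamma : R) (mu a x : 'cV[R]_n) : R :=
  gamma / 2 * (a^T *m (x - mu) *m (x - mu)^T *m a) 0 0 - dot a x.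

Definition mv_domain (gamma : R) (Sigma : 'M[R]_n) : set (R * 'cV[R]_n) :=
  [set p | [/\ 0 < p.1, portfolios p.2 &
               p.1 * quad_form Sigma p.2 < gamma^-1]].

Context {d : measure_display} {T : measurableType d} {P : probability T R}.

Definition nominal_portfolio (gamma : R) (mu : 'cV[R]_n)
    (X : 'I_n -> {RV P >-> R}) : 'cV[R]_n :=
  argmin 0 portfolios
    (fun a => 'E_P[fun w => mv_risk gamma mu a (vec_of X w)])%E.

(* The objective is kept in the extended reals, so an infinite exponential
   moment counts as +oo. *)
Definition worst_case_portfolio (gamma : R) (mu : 'cV[R]_n) (Sigma : 'M[R]_n)
    (X : 'I_n -> {RV P >-> R}) (theta : R) : 'cV[R]_n :=
  argmin 0 [set a | mv_domain gamma Sigma (theta, a)]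
    (fun a => (theta^-1)%:E *
       lne 'E_P[fun w => expR (theta * mv_risk gamma mu a (vec_of X w))])%E.

End portfolios.

(* Main.v *)
(* For Y ~ N(m, v) with m = a^T mu, v = a^T Sigma a, completing the square gives
     E[exp(theta V_a)] = exp(- theta m + theta^2 v / (2 D)) / sqrt D
   with D = 1 - theta gamma v,
   so the worst-case objective is h(v) - m, where h has slope at least
   (gamma + theta) / 2; the nominal one, (gamma / 2) v - m, is the derivative of
   the moment generating function of V_a at 0.
   The nominal optimum is the portfolio a with gamma Sigma a = mu + l 1.  If a
   is also worst-case optimal, move it along z with z^T 1 = 0: if z^T Sigma a
   were nonzero, the slope of h, which exceeds gamma / 2, would beat the
   first-order balance gamma z^T Sigma a = z^T mu.  Hence z^T Sigma a = 0, so
   z^T mu = 0 for all such z, i.e. mu is proportional to 1.  Conversely, if mu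
   is proportional to 1, then a^T mu is constant on portfolios and both problems
   minimise the variance. *)

Require Import Defs.
From HB Require Import structures.
From mathcomp Require Import all_boot all_order all_algebra.
From mathcomp Require Import all_classical all_reals all_analysis.
From mathcomp Require Import measurable_realfun ring lra.
Import Order.TTheory GRing.Theory Num.Theory.
Import numFieldNormedType.Exports.

Local Open Scope classical_set_scope.
Local Open Scope ring_scope.

(** * Gaussian moments of quadratics and of their exponentials *)

(** Change of variables applies to the Radon-Nikodym derivative, which agrees almost everywhere with
    [normal_pdf] because both have the same integral over every measurable set. *)
Lemma ge0_integral_normal_prob (R : realType) (m s : R) (f : R -> \bar R) :
    (forall x, 0 <= f x)%E -> measurable_fun setT f ->
  (\int[normal_prob m s]_x f x =
   \int[lebesgue_measure]_x (f x * (normal_pdf m s x)%:E))%E.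
Proof.
move=> f0 mf; have dom := normal_prob_dominates m s.
have mpdf : measurable_fun setT (EFin \o normal_pdf m s).
  by apply/measurable_EFinP; exact: measurable_normal_pdf.
rewrite -(Radon_Nikodym_SigmaFinite.change_of_variables dom)//.
have intRN := Radon_Nikodym_SigmaFinite.f_integrable dom.
have mRN := measurable_int _ intRN.
apply: ge0_ae_eq_integral => //.
- exact: emeasurable_funM.
- exact: emeasurable_funM.
- by move=> x _; rewrite mule_ge0// Radon_Nikodym_SigmaFinite.f_ge0.
- by move=> x _; rewrite mule_ge0// lee_fin normal_pdf_ge0.
- apply: ae_eqe_mul2l; apply: integral_ae_eq => // E _ mE.
  by rewrite -Radon_Nikodym_SigmaFinite.f_integral.
Qed.

Lemma sqrtr_expR_ln (R : realType) (x : R) : 0 < x ->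
  Num.sqrt x = expR (ln x / 2).
Proof.
move=> x0; rewrite -[in LHS](lnK x0) -[X in expR X](@divfK _ 2)// mulr_natr.
by rewrite mulr2n expRD -expr2 sqrtr_sqr ger0_norm ?expR_ge0.
Qed.

(** Completing the square turns integrand times density into a constant [K] times the normal density
    with variance w = v / (1 - 2 p v) and mean m + q w, which integrates to 1. *)
Lemma integral_normal_prob_expR_sqr (R : realType) (m v p q r : R) :
    0 < v -> 2 * p * v < 1 ->
  (\int[normal_prob m (Num.sqrt v)]_x
     (expR (p * (x - m) ^+ 2 + q * (x - m) + r))%:E =
   (expR (r + q ^+ 2 * v / (2 * (1 - 2 * p * v)) -
          ln (1 - 2 * p * v) / 2))%:E)%E.
Proof.
move=> v0 pv; set rho := 1 - 2 * p * v.
have rho0 : 0 < rho by rewrite /rho; lra.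
set w := v / rho; have w0 : 0 < w by rewrite divr_gt0.
have vE : v = rho * w by rewrite /w mulrC divfK// gt_eqF.
set K := expR (r + _ - _).
have sv0 : Num.sqrt v != 0 by rewrite gt_eqF// sqrtr_gt0.
have sw0 : Num.sqrt w != 0 by rewrite gt_eqF// sqrtr_gt0.
rewrite ge0_integral_normal_prob//; last first.
  apply/measurable_EFinP; apply: measurableT_comp => //.
  apply: measurable_funD => //; apply: measurable_funD => //.
    apply: measurable_funM => //; apply: measurable_funX => //.
    exact: measurable_funB.
  by apply: measurable_funM => //; exact: measurable_funB.
transitivity (\int[lebesgue_measure]_x
    (K%:E * (normal_pdf (m + q * w) (Num.sqrt w) x)%:E))%E; last first.
  by rewrite integralZl ?integral_normal_pdf ?mule1//;
    exact: integrable_normal_pdf.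
apply: eq_integral => x _; rewrite -!EFinM; congr EFin.
rewrite !normal_pdfE// /normal_peak /normal_fun !sqr_sqrtr ?ltW//.
(* The ratio of the two normalising factors is 1 / sqrt rho, the source of the term - ln rho / 2. *)
have -> : v * pi *+ 2 = rho * (w * pi *+ 2)
  by rewrite {1}vE -mulrA -mulrnAr.
rewrite sqrtrM ?ltW// sqrtr_expR_ln// invfM -expRN.
set pk := (Num.sqrt _)^-1.
rewrite (mulrAC _ pk) mulrA (mulrC pk) (mulrA K); congr (_ * _).
rewrite /K -!expRD; congr expR.
rewrite -(mulr_natr v) -(mulr_natr w) -/rho.
have -> : p = (1 - rho) / (2 * v) by rewrite /rho; field; lra.
rewrite vE; move: (rho) (w) rho0 w0; clear => rho w rho0 w0; field; lra.
Qed.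

(* [M t - (1 + t * E W)] is nonnegative by [1 + x <= expR x] and vanishes at 0,
   so its derivative there is 0. *)
Lemma expectation_derive_mgf (R : realType) (d : measure_display)
    (T : measurableType d) (P : probability T R) (W : T -> R) (M : R -> R)
    (e l : R) :
    0 < e -> measurable_fun setT W ->
    (forall t, - e < t < e ->
      'E_P[fun w => expR (t * W w)]%E = (M t)%:E) ->
    (forall t, - e < t < e -> derivable M t 1) ->
    is_derive (0 : R) (1 : R) M l ->
  ('E_P[W] = l%:E)%E.
Proof.
move=> e0 mW ME dM dM0.
have mexp t : measurable_fun setT (fun w => expR (t * W w)).
  by apply: measurableT_comp => //; exact: measurable_funM.
have iexp t : - e < t < e ->
    P.-integrable setT (fun w => (expR (t * W w))%:E).
  move=> te; apply/integrableP; split; first exact/measurable_EFinP.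
  under eq_integral do rewrite /= ger0_norm ?expR_ge0//.
  by have := ME t te; rewrite unlock => ->; rewrite ltry.
have e2 : - e < e / 2 < e by lra.
have e2N : - e < - (e / 2) < e by lra.
(* Domination: (e / 2) |W| is at most exp (e W / 2) + exp (- e W / 2). *)
have iW : P.-integrable setT (EFin \o W).
  have := integrableD measurableT (iexp _ e2) (iexp _ e2N).
  move=> /(integrableZl measurableT (e / 2)^-1); apply: le_integrable => //.
    exact/measurable_EFinP.
  move=> w _ /=; rewrite lee_fin [leRHS]ger0_norm; last first.
    by rewrite mulr_ge0 ?invr_ge0 ?addr_ge0 ?expR_ge0//; lra.
  rewrite mulrC ler_pdivlMr; last lra.
  have := expR_ge1Dx (e / 2 * W w); have := expR_ge1Dx (- (e / 2) * W w).
  have := expR_ge0 (e / 2 * W w); have := expR_ge0 (- (e / 2) * W w).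
  by case: (lerP 0 (W w)) => W0; [rewrite ger0_norm|rewrite ltr0_norm]; lra.
have [r rE] : exists r, ('E_P[W] = r%:E)%E.
  exists (fine 'E_P[W]); rewrite unlock fineK//.
  exact: integrable_fin_num.
have tangent t : - e < t < e -> 1 + t * r <= M t.
  move=> te; rewrite -lee_fin -ME// EFinD EFinM -rE.
  have itW : P.-integrable setT (fun w => t%:E * (W w)%:E)%E.
    exact: integrableZl.
  have i1 : P.-integrable setT (fun=> 1%E : \bar R).
    by apply: finite_measure_integrable_cst.
  have <- : (\int[P]_w (1 + t%:E * (W w)%:E) = 1 + t%:E * 'E_P[W])%E.
    rewrite integralD// integralZl// integral_cst//.
    by rewrite /= probability_setT mule1 unlock.
  rewrite unlock.
  by apply: le_integral => //; [exact: integrableD|exact: iexp|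
    move=> w _; rewrite -EFinM -EFinD lee_fin expR_ge1Dx].
have M0 : M 0 = 1.
  have := ME 0; rewrite oppr_lt0 e0 => /(_ isT).
  under [X in 'E_P[X]%E]eq_fun do rewrite mul0r expR0.
  by rewrite expectation_cst => -[].
pose g t := M t - (1 + t * r).
have dg t : - e < t < e -> derivable g t 1.
  by move=> te; apply: derivableB; [exact: dM|].
have gl : is_derive (0 : R) (1 : R) g (l - r).
  rewrite /g; apply: is_derive_eq.
  by rewrite scaler0 !add0r mul1r /GRing.scale/= mulr1.
have g0 : is_derive (0 : R) (1 : R) g 0.
  have dg' t : t \in `](- e), e[ -> derivable g t 1.
    by rewrite in_itv; exact: dg.
  have zero_in : 0 \in `](- e), e[ by rewrite in_itv/= oppr_lt0 e0.
  apply: (derive1_at_min _ dg' zero_in); first lra.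
  move=> t; rewrite in_itv/= => te.
  by rewrite /g M0 mul0r addr0 subrr subr_ge0 tangent.
rewrite rE; congr EFin; apply/esym/eqP; rewrite -subr_eq0; apply/eqP.
by rewrite -(@derive_val _ _ _ _ _ _ _ gl) (@derive_val _ _ _ _ _ _ _ g0).
Qed.

Lemma expectation_expR_sqr_normal (R : realType) (d : measure_display)
    (T : measurableType d) (P : probability T R) (Y : T -> R)
    (m v p q r : R) :
    measurable_fun setT Y ->
    (forall A, measurable A -> pushforward P Y A = normal_law m v A) ->
    0 < v -> 2 * p * v < 1 ->
  'E_P[fun w => expR (p * (Y w - m) ^+ 2 + q * (Y w - m) + r)]%E =
  (expR (r + q ^+ 2 * v / (2 * (1 - 2 * p * v)) -
         ln (1 - 2 * p * v) / 2))%:E.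
Proof.
move=> mY YN v0 pv; rewrite -(integral_normal_prob_expR_sqr _ m)// unlock.
have mf : measurable_fun setT
    (fun x : R => (expR (p * (x - m) ^+ 2 + q * (x - m) + r))%:E).
  apply/measurable_EFinP; apply: measurableT_comp => //.
  apply: measurable_funD => //; apply: measurable_funD => //.
    apply: measurable_funM => //; apply: measurable_funX => //.
    exact: measurable_funB.
  by apply: measurable_funM => //; exact: measurable_funB.
(* [normal_prob] is a measure on [measurableTypeR R], whose display differs
   from that of the measurable structure inferred for [R]. *)
have mY' : measurable_fun setT (Y : T -> measurableTypeR R) by exact: mY.
pose Y' : {mfun T >-> measurableTypeR R} :=
  HB.pack (Y : T -> measurableTypeR R) (isMeasurableFun.Build _ _ _ _ _ mY').
have /= <- := @ge0_integral_distribution _ _ _ _ _ P Y' _ mf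
  (fun=> expR_ge0 _).
apply: eq_measure_integral => A mA _; rewrite [LHS]YN//.
by rewrite /normal_law gt_eqF.
Qed.

(** [K] is the log moment generating function of p (Y - m)^2 + q (Y - m) + r for Y normal with mean
    m and variance v: the preceding formula with p, q, r scaled by t. At t = 0 the derivative is p v
    + r. *)
Lemma is_derive_mgf_sqr_normal (R : realType) (v p q r t : R) :
    2 * (t * p) * v < 1 ->
  let D := 1 - 2 * (t * p) * v in
  let K t := t * r + (t * q) ^+ 2 * v / (2 * (1 - 2 * (t * p) * v)) -
             ln (1 - 2 * (t * p) * v) / 2 in
  is_derive (t : R) (1 : R) (fun t => expR (K t))
    (expR (K t) *
     (r + (t * q ^+ 2 * v * D + t ^+ 2 * q ^+ 2 * p * v ^+ 2) / D ^+ 2 +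
      p * v / D)).
Proof.
move=> tpv D K.
have D0 : 0 < D by rewrite /D; lra.
have Dn : 2 * D != 0 by rewrite mulf_neq0// gt_eqF.
have dD : is_derive (t : R) (1 : R) (fun t => 1 - 2 * (t * p) * v)
    (- (2 * p * v)).
  by apply: is_derive_eq; rewrite /GRing.scale/=; ring.
have dln : is_derive (t : R) (1 : R) (fun t => ln (1 - 2 * (t * p) * v))
    (D^-1 * - (2 * p * v)).
  exact: (@is_derive1_comp R (@ln R) _ t _ _ (is_derive1_ln D0 :
    is_derive ((fun t => 1 - 2 * (t * p) * v) t) 1 (@ln R) D^-1) dD).
have d2D : is_derive (t : R) (1 : R) (fun t => 2 * (1 - 2 * (t * p) * v))
    (2 * - (2 * p * v)).
  by apply: is_derive_eq; rewrite /GRing.scale/=; ring.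
have dV := @is_deriveV R (fun t => 2 * (1 - 2 * (t * p) * v)) t _ _ Dn d2D.
apply: (@is_derive1_comp _ expR K); rewrite /K.
apply: is_derive_eq.
rewrite /GRing.scale/= -/D.
by field; rewrite gt_eqF.
Qed.

Lemma expectation_sqr_normal (R : realType) (d : measure_display)
    (T : measurableType d) (P : probability T R) (Y : T -> R)
    (m v p q r : R) :
    measurable_fun setT Y ->
    (forall A, measurable A -> pushforward P Y A = normal_law m v A) ->
    0 < v -> 0 <= p ->
  'E_P[fun w => (p * (Y w - m) ^+ 2 + q * (Y w - m) + r)%R]%E = (p * v + r)%:E.
Proof.
move=> mY YN v0 p0; have pv0 : 0 <= p * v by rewrite mulr_ge0// ltW.
(* For 0 <= t < e this gives 2 t p v + t < 1; the summand 1 keeps [e] positive when p = 0. *)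
pose e := (2 * (p * v) + 1)^-1.
have e0 : 0 < e by rewrite invr_gt0; lra.
have small t : - e < t < e -> 2 * (t * p) * v < 1.
  move=> /andP[_]; rewrite /e -[X in _ < X]mul1r ltr_pdivlMr; last lra.
  have [t0|t0] := lerP 0 t; first by lra.
  by have : t * (p * v) <= 0 by [rewrite mulr_le0_ge0// ltW]; lra.
have mW : measurable_fun setT
    (fun w => p * (Y w - m) ^+ 2 + q * (Y w - m) + r).
  apply: measurable_funD => //; apply: measurable_funD => //.
    apply: measurable_funM => //; apply: measurable_funX => //.
    exact: measurable_funB.
  by apply: measurable_funM => //; exact: measurable_funB.
pose M t := expR (t * r + (t * q) ^+ 2 * v /
  (2 * (1 - 2 * (t * p) * v)) - ln (1 - 2 * (t * p) * v) / 2).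
apply: (@expectation_derive_mgf _ _ _ _ _ M e _ e0 mW) => [t te|t te|].
- rewrite /M -(@expectation_expR_sqr_normal _ _ _ _ _ _ _ _ _ _ mY YN v0
    (small t te)).
  by congr expectation; apply/funext => w; congr expR; ring.
- by apply: ex_derive; apply: is_derive_mgf_sqr_normal; exact: small.
- apply: is_derive_eq.
    by apply: is_derive_mgf_sqr_normal; rewrite mul0r mulr0 mul0r.
  rewrite !mul0r !mulr0 !mul0r subr0 ln1.
  by rewrite expr0n/= !mul0r addr0 subr0 expR0; field.
Qed.

Section dot_theory.
Context {R : realType} {n : nat}.
Implicit Types (x y z : 'cV[R]_n) (S : 'M[R]_n) (k : R).

Lemma dotE x y : dot x y = \sum_i x i 0 * y i 0.
Proof. by rewrite /dot mxE; apply: eq_bigr => i _; rewrite mxE. Qed.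

Lemma dotC x y : dot x y = dot y x.
Proof. by rewrite !dotE; apply: eq_bigr => i _; rewrite mulrC. Qed.

Lemma dotDr x y z : dot x (y + z) = dot x y + dot x z.
Proof. by rewrite /dot mulmxDr mxE. Qed.

Lemma dotZr k x y : dot x (k *: y) = k * dot x y.
Proof. by rewrite /dot -scalemxAr mxE. Qed.

Lemma dotDl x y z : dot (x + y) z = dot x z + dot y z.
Proof. by rewrite !(dotC _ z) dotDr. Qed.

Lemma dotZl k x y : dot (k *: x) y = k * dot x y.
Proof. by rewrite !(dotC _ y) dotZr. Qed.

Lemma dotBl x y z : dot (x - y) z = dot x z - dot y z.
Proof. by rewrite dotDl -scaleN1r dotZl mulN1r. Qed.

Lemma dotBr x y z : dot x (y - z) = dot x y - dot x z.
Proof. by rewrite !(dotC x) dotBl. Qed.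

Lemma dot0l x : dot 0 x = 0.
Proof. by rewrite /dot trmx0 mul0mx mxE. Qed.

Lemma dotxx_eq0 x : dot x x = 0 -> x = 0.
Proof.
rewrite dotE => /eqP; rewrite psumr_eq0; last first.
  by move=> i _; rewrite -expr2 sqr_ge0.
move=> /allP x0; apply/colP => i; rewrite mxE; apply/eqP.
by have := x0 i (mem_index_enum i); rewrite mulf_eq0 orbb.
Qed.

Lemma quad_formE S x : quad_form S x = dot x (S *m x).
Proof. by rewrite /quad_form /dot mulmxA. Qed.

Lemma dot_sym S x y : S^T = S -> dot x (S *m y) = dot y (S *m x).
Proof.
move=> symS; rewrite -{1}symS.
by rewrite dotC /dot trmx_mul trmxK -mulmxA.
Qed.

Lemma quad_formD S x y k : S^T = S ->
  quad_form S (x + k *: y) =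
  quad_form S x + 2 * k * dot y (S *m x) + k ^+ 2 * quad_form S y.
Proof.
move=> symS; rewrite !quad_formE mulmxDr -scalemxAr !dotDl !dotDr !dotZl !dotZr.
by rewrite (@dot_sym S x y symS); ring.
Qed.

Lemma posdef_sym_ge0 S x : posdef_sym S -> 0 <= quad_form S x.
Proof.
move=> [_ posS]; have [->|/posS/ltW//] := eqVneq x 0.
by rewrite quad_formE dot0l.
Qed.

(** A nonzero row in the left kernel would have a vanishing quadratic form. *)
Lemma posdef_sym_unitmx S : posdef_sym S -> S \in unitmx.
Proof.
move=> [_ posS]; rewrite -row_free_unit; apply: inj_row_free => u uS0.
apply/eqP; rewrite -trmx_eq0; apply/negPn/negP => /posS.
by rewrite /quad_form trmxK uS0 mul0mx mxE ltxx.
Qed.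

End dot_theory.

Lemma ones_neq0 (R : realType) (n : nat) : (1 <= n)%N -> (ones : 'cV[R]_n) != 0.
Proof.
case: n => // n _; apply/eqP => /colP/(_ 0); rewrite !mxE => /eqP.
by rewrite oner_eq0.
Qed.

(** * Unique minimisers *)

Lemma argmin_eq (R : realType) (U : choiceType) (u0 a : U) (C : set U)
    (f : U -> \bar R) :
  C a -> (forall b, C b -> b != a -> (f a < f b)%E) -> argmin u0 C f = a.
Proof.
move=> Ca fa.
have mina : minimiser C f a.
  by split=> // b Cb; have [->//|/(fa _ Cb)/ltW] := eqVneq b a.
have uniqa b : minimiser C f b -> a = b.
  move=> [Cb fb]; have [//|/(fa _ Cb)] := eqVneq b a.
  by rewrite ltNge fb.
apply: xget_unique; first by split.
by move=> b [minb _]; exact/esym/uniqa.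
Qed.

Lemma argmin_minimiser (R : realType) (U : choiceType) (u0 : U) (C : set U)
    (f : U -> \bar R) :
  argmin u0 C f != u0 -> minimiser C f (argmin u0 C f).
Proof. by rewrite /argmin; case: xgetP => [a _ []|_ /eqP]. Qed.

(** * Growth of the worst-case objective in the variance *)

(** The function h of the overview: the worst-case objective without its term - a^T mu, as a
    function of the variance. *)
Definition entropic_penalty {R : realType} (gamma theta v : R) : R :=
  theta * v / (2 * (1 - theta * gamma * v)) -
  ln (1 - theta * gamma * v) / (2 * theta).

Lemma entropic_penalty_slope (R : realType) (gamma theta w v : R) :
    0 < gamma -> 0 < theta -> 0 <= w -> w <= v -> theta * gamma * v < 1 ->
  (gamma + theta) / 2 * (v - w) <=
  entropic_penalty gamma theta v - entropic_penalty gamma theta w.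
Proof.
move=> g0 t0 w0 wv v1; rewrite /entropic_penalty.
have tg0 : 0 < theta * gamma by rewrite mulr_gt0.
have tgwv : theta * gamma * w <= theta * gamma * v by rewrite ler_pM2l.
have tgw0 : 0 <= theta * gamma * w by rewrite mulr_ge0// ltW.
set a := 1 - theta * gamma * v; set b := 1 - theta * gamma * w.
have a0 : 0 < a by rewrite /a; lra.
have ab : a <= b by rewrite /a /b; lra.
have b0 : 0 < b by lra.
have b1 : b <= 1 by rewrite /b; lra.
(* Here - ln (a / b) >= 1 - a / b = (b - a) / b >= b - a, since b <= 1. *)
have lnab : b - a <= ln b - ln a.
  rewrite -lerN2 opprB -ln_div ?posrE// opprB.
  have := @le_ln1Dx _ (a / b - 1); rewrite (addrC 1) subrK => lnle.
  apply: (le_trans (lnle _)); first by have := divr_gt0 a0 b0; lra.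
  rewrite lerBlDr ler_pdivrMr//; nra.
have quot : v - w <= v / a - w / b.
  have va : v / b <= v / a by rewrite ler_wpM2l ?lef_pV2 ?posrE//; lra.
  have : v - w <= (v - w) / b by rewrite ler_pdivlMr//; nra.
  by rewrite mulrBl; lra.
have -> : theta * v / (2 * a) = theta / 2 * (v / a) by field; rewrite gt_eqF.
have -> : theta * w / (2 * b) = theta / 2 * (w / b) by field; rewrite gt_eqF.
have : theta / 2 * (v - w) <= theta / 2 * (v / a - w / b).
  by rewrite ler_pM2l; lra.
have : (2 * theta)^-1 * (b - a) <= (2 * theta)^-1 * (ln b - ln a).
  by rewrite ler_pM2l// invr_gt0; lra.
have -> : (2 * theta)^-1 * (b - a) = gamma / 2 * (v - w).
  by rewrite /a /b; field; rewrite gt_eqF.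
lra.
Qed.

(** * Closed forms of the two objectives *)

Section objectives.
Context {R : realType} {d : measure_display} {T : measurableType d}
  {P : probability T R} {n : nat}.
Context (mu : 'cV[R]_n) (Sigma : 'M[R]_n) (X : 'I_n -> {RV P >-> R})
  (X_gaussian : gaussian_vector mu Sigma X) (gamma : R).

(** The risk depends on x only through a^T x; this is the quadratic shape of the Gaussian lemmas,
    with p = gamma / 2, q = -1 and r = - a^T mu. *)
Lemma mv_riskE (a x : 'cV[R]_n) : mv_risk gamma mu a x =
  gamma / 2 * (dot a x - dot a mu) ^+ 2 + (- 1) * (dot a x - dot a mu) +
  (- dot a mu).
Proof.
rewrite /mv_risk -mulmxA mxE big_ord1.
rewrite -[X in _ * (X * _)]/(dot a (x - mu)).
rewrite -[X in _ * (_ * X)]/(dot (x - mu) a) (dotC _ a) dotBr; ring.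
Qed.

Lemma measurable_dot (a : 'cV[R]_n) :
  measurable_fun setT (fun w => dot a (vec_of X w)).
Proof.
have -> : (fun w => dot a (vec_of X w)) = fun w => \sum_i a i 0 * X i w.
  by apply/funext => w; rewrite dotE; apply: eq_bigr => i _; rewrite mxE.
by apply: measurable_sum => i; exact: measurable_funM.
Qed.

Lemma nominal_objective (a : 'cV[R]_n) :
    0 < gamma -> 0 < quad_form Sigma a ->
  'E_P[fun w => mv_risk gamma mu a (vec_of X w)]%E =
  (gamma / 2 * quad_form Sigma a - dot a mu)%:E.
Proof.
move=> g0 v0; under [X in 'E_P[X]%E]eq_fun do rewrite mv_riskE.
apply: expectation_sqr_normal => //; last by rewrite divr_ge0// ltW.
  exact: measurable_dot.
by move=> A; exact: X_gaussian.
Qed.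

Lemma worst_case_objective (theta : R) (a : 'cV[R]_n) :
    0 < theta -> 0 < quad_form Sigma a ->
    theta * gamma * quad_form Sigma a < 1 ->
  ((theta^-1)%:E * lne
     'E_P[fun w => expR (theta * mv_risk gamma mu a (vec_of X w))])%E =
  (entropic_penalty gamma theta (quad_form Sigma a) - dot a mu)%:E.
Proof.
move=> t0; set v := quad_form Sigma a => v0 tv.
have pE : 2 * (theta * gamma / 2) = theta * gamma by field.
have pv : 2 * (theta * gamma / 2) * v < 1 by rewrite pE.
have := expectation_expR_sqr_normal _ _ _ _ _ _ _ _
  (- theta) (- theta * dot a mu) (measurable_dot a) (X_gaussian a) v0 pv.
set F := (F in 'E_P[F]%E); set G := (G in _ -> (_ * lne 'E_P[G])%E = _).
have -> : F = G.
  by apply/funext => w; rewrite /F /G mv_riskE; congr expR; field.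
move=> ->; rewrite lne_EFin ?expR_gt0// expRK -EFinM; congr EFin.
rewrite pE -/v /entropic_penalty; set D := 1 - _.
have D0 : 0 < D by rewrite /D; lra.
by field; rewrite !gt_eqF.
Qed.

End objectives.

(** * The stationary portfolio and the nominal optimum *)

Section mean_variance.
Context {R : realType} {n : nat} (mu : 'cV[R]_n) (Sigma : 'M[R]_n).
Context (Sigma_posdef : posdef_sym Sigma) (gamma : R) (gamma_gt0 : 0 < gamma).

Lemma portfolio_neq0 (a : 'cV[R]_n) : portfolios a -> a != 0.
Proof.
rewrite /portfolios/= => a1; apply/eqP => a0; move: a1.
by rewrite a0 dot0l => /esym/eqP; rewrite oner_eq0.
Qed.

Lemma quad_form_portfolio_gt0 (a : 'cV[R]_n) :
  portfolios a -> 0 < quad_form Sigma a.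
Proof. by move=> /portfolio_neq0; case: Sigma_posdef => _; apply. Qed.

(** Solve for a = Sigma^-1 (mu + l 1) / gamma and choose the Lagrange multiplier [l] to meet the
    budget constraint. The divisor [c] is the quadratic form of Sigma at Sigma^-1 1, hence
    positive. *)
Lemma stationary_portfolio_exists : (1 <= n)%N ->
  exists a l, portfolios a /\ gamma *: (Sigma *m a) = mu + l *: ones.
Proof.
move=> n1; have unitS := posdef_sym_unitmx _ Sigma_posdef.
set c := dot (invmx Sigma *m ones) ones.
have c0 : 0 < c.
  have i1 : invmx Sigma *m ones != 0.
    apply: contra_neq (ones_neq0 R _ n1) => i10.
    by rewrite -[LHS](mulKVmx unitS) i10 mulmx0.
  case: Sigma_posdef => _ /(_ _ i1).
  by rewrite quad_formE mulKVmx.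
pose l := (gamma - dot (invmx Sigma *m mu) ones) / c.
exists (gamma^-1 *: (invmx Sigma *m (mu + l *: ones))), l; split; last first.
  by rewrite -scalemxAr mulKVmx// scalerA mulfV ?gt_eqF// scale1r.
rewrite /portfolios/= dotZl mulmxDr -scalemxAr dotDl dotZl -/c /l.
by field; rewrite !gt_eqF.
Qed.

Context (a : 'cV[R]_n) (l : R) (a_portfolio : portfolios a)
  (a_stationary : gamma *: (Sigma *m a) = mu + l *: ones).

Lemma stationaryE (z : 'cV[R]_n) :
  gamma * dot z (Sigma *m a) = dot z mu + l * dot z ones.
Proof. by rewrite -dotZr a_stationary dotDr dotZr. Qed.

Lemma dot_portfolioB (b : 'cV[R]_n) : portfolios b -> dot (b - a) ones = 0.
Proof. by rewrite dotBl => ->; rewrite a_portfolio subrr. Qed.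

Lemma quad_form_portfolioB (b : 'cV[R]_n) :
  quad_form Sigma b = quad_form Sigma a + 2 * dot (b - a) (Sigma *m a) +
    quad_form Sigma (b - a).
Proof.
rewrite -[in LHS](subrKC a b) -[X in a + X]scale1r quad_formD; last first.
  by case: Sigma_posdef.
by rewrite mulr1 expr1n mul1r.
Qed.

Context {d : measure_display} {T : measurableType d} {P : probability T R}
  (X : 'I_n -> {RV P >-> R}) (X_gaussian : gaussian_vector mu Sigma X).

(** Expanding around [a], stationarity cancels the first-order term, and the excess at b is gamma /
    2 times the quadratic form at b - a. *)
Lemma nominal_portfolio_stationary : nominal_portfolio gamma mu X = a.
Proof.
apply: argmin_eq => // b b1 ba.
rewrite !(nominal_objective _ _ _ X_gaussian)//;
  try exact: quad_form_portfolio_gt0.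
rewrite lte_fin (quad_form_portfolioB b).
have := stationaryE (b - a).
rewrite dot_portfolioB// mulr0 addr0 (dotBl b a mu) => zE.
have : 0 < gamma * quad_form Sigma (b - a).
  by rewrite mulr_gt0//; case: Sigma_posdef => _; apply; rewrite subr_eq0.
lra.
Qed.

(** * The worst-case optimum *)

Context (theta : R) (theta_gt0 : 0 < theta).

Lemma mv_domainE (b : 'cV[R]_n) : mv_domain gamma Sigma (theta, b) <->
  portfolios b /\ theta * gamma * quad_form Sigma b < 1.
Proof.
have E : (theta * quad_form Sigma b < gamma^-1) =
         (theta * gamma * quad_form Sigma b < 1).
  by rewrite -[X in _ < X]mul1r ltr_pdivlMr// mulrAC.
by rewrite /mv_domain/= E; split=> [[]|[]].
Qed.

(** Now Sigma a is proportional to 1, so the variance of b is that of [a] plus the quadratic form at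
    b - a. Thus [a] has strictly least variance, while the mean is constant and the penalty strictly
    increasing. *)
Lemma worst_case_portfolio_proportional (m : R) :
    mu = m *: ones -> (exists b, mv_domain gamma Sigma (theta, b)) ->
  worst_case_portfolio gamma mu Sigma X theta = a.
Proof.
move=> muE [b0 /mv_domainE[b01 b0D]].
have quadE b : portfolios b ->
    quad_form Sigma b = quad_form Sigma a + quad_form Sigma (b - a).
  move=> b1; rewrite quad_form_portfolioB.
  have := stationaryE (b - a); rewrite muE dotZr dot_portfolioB// !mulr0 addr0.
  by move=> /eqP; rewrite mulf_eq0 gt_eqF//= => /eqP ->; rewrite mulr0 addr0.
have muP b : portfolios b -> dot b mu = m.
  by rewrite /portfolios/= muE dotZr => ->; rewrite mulr1.
have tg0 : 0 < theta * gamma by rewrite mulr_gt0.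
(* Feasibility passes from [b0] to [a], whose variance is no larger. *)
have aD : theta * gamma * quad_form Sigma a < 1.
  apply: le_lt_trans b0D; rewrite ler_pM2l// (quadE b0)//.
  by rewrite lerDl posdef_sym_ge0.
apply: argmin_eq => [|b /mv_domainE[b1 bD] ba]; first exact/mv_domainE.
rewrite !(worst_case_objective _ _ _ X_gaussian)//;
  try exact: quad_form_portfolio_gt0.
rewrite lte_fin !muP// ltrD2r.
have z0 : 0 < quad_form Sigma (b - a).
  by case: Sigma_posdef => _; apply; rewrite subr_eq0.
have := @entropic_penalty_slope _ gamma theta (quad_form Sigma a)
  (quad_form Sigma b) gamma_gt0 theta_gt0 (posdef_sym_ge0 _ _ Sigma_posdef).
rewrite (quadE b b1) in bD *; rewrite lerDl => /(_ (ltW z0) bD).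
have : 0 < (gamma + theta) / 2 * quad_form Sigma (b - a).
  by rewrite mulr_gt0// divr_gt0// addr_gt0.
lra.
Qed.

Lemma worst_case_portfolio_orthogonal (z : 'cV[R]_n) :
    worst_case_portfolio gamma mu Sigma X theta = a -> dot z ones = 0 ->
  dot z (Sigma *m a) = 0.
Proof.
move=> wcE z1; apply/eqP/negP => /negP q0; set q := dot z _ in q0.
have [/mv_domainE[_ aD] mina] : minimiser
    [set b | mv_domain gamma Sigma (theta, b)]
    (fun b => (theta^-1)%:E * lne
       'E_P[fun w => expR (theta * mv_risk gamma mu b (vec_of X w))])%E a.
  (* The default value 0 of [argmin] is not a portfolio, so [a] is a genuine minimiser. *)
  rewrite -wcE; apply: argmin_minimiser.
  by rewrite -/(worst_case_portfolio _ _ _ _ _) wcE portfolio_neq0.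
set v := quad_form Sigma a in aD; set s := quad_form Sigma z.
have s0 : 0 <= s by exact: posdef_sym_ge0.
have v0 : 0 < v by exact: quad_form_portfolio_gt0.
have tg0 : 0 < theta * gamma by rewrite mulr_gt0.
have qq : 0 < q ^+ 2 by rewrite exprn_even_gt0.
(* Moving from [a] to [a - k q z] lowers the variance by [k q^2 (2 - k s)]; this
   [k] makes the second-order term [k s] negligible. *)
pose k := theta / ((gamma + theta) * (s + 1)).
have gt0 : 0 < gamma + theta by rewrite addr_gt0.
have s1 : 0 < s + 1 by lra.
have k0 : 0 < k by rewrite divr_gt0// mulr_gt0.
have ks : (gamma + theta) * (k * s) < theta.
  have -> : (gamma + theta) * (k * s) = theta * (s / (s + 1)).
    by rewrite /k; field; rewrite !gt_eqF.
  by rewrite gtr_pMr// ltr_pdivrMr; lra.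
have ks1 : k * s < 1.
  by rewrite -(ltr_pM2l gt0); have := gamma_gt0; lra.
pose b := a + (- (k * q)) *: z.
have b1 : portfolios b.
  by rewrite /portfolios/= /b dotDl dotZl z1 mulr0 addr0.
set w := quad_form Sigma b.
have wE : v - w = k * q ^+ 2 * (2 - k * s).
  rewrite /w quad_formD; last by case: Sigma_posdef.
  by rewrite -/v -/s -/q; ring.
have wv : w <= v.
  by rewrite -subr_ge0 wE; apply: mulr_ge0; [exact/ltW/mulr_gt0|lra].
have w0 : 0 < w by exact: quad_form_portfolio_gt0.
have bD : theta * gamma * w < 1.
  by apply: le_lt_trans aD; rewrite ler_pM2l.
have := mina b; rewrite !(worst_case_objective _ _ _ X_gaussian)//.
move=> /(_ ((mv_domainE b).2 (conj b1 bD))); rewrite lee_fin -/v -/w.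
have -> : dot b mu = dot a mu - gamma * (k * q ^+ 2).
  have := stationaryE z; rewrite z1 mulr0 addr0 -/q => zmu.
  by rewrite /b dotDl dotZl -zmu; ring.
(* The objective at [a] exceeds that at [b] by at least k q^2 (theta - (gamma + theta) k s / 2),
   which is positive by the choice of [k]; this contradicts minimality. *)
have := @entropic_penalty_slope _ gamma theta w v gamma_gt0 theta_gt0 (ltW w0)
  wv aD.
rewrite wE => slope minab.
have kq0 : 0 < k * q ^+ 2 by rewrite mulr_gt0.
have : k * q ^+ 2 * ((gamma + theta) * (k * s)) < k * q ^+ 2 * theta.
  by rewrite ltr_pM2l.
move: kq0 slope minab; set kq := k * q ^+ 2 => kq0 slope minab ksq.
have : 0 < kq * theta by rewrite mulr_gt0.
lra.
Qed.

End mean_variance.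

(** * Equality of the optima and proportionality of the mean to 1 *)

Theorem proposition12 (R : realType) (d : measure_display)
    (T : measurableType d) (P : probability T R) (n : nat)
    (mu : 'cV[R]_n) (Sigma : 'M[R]_n) (X : 'I_n -> {RV P >-> R})
    (gamma theta : R)
    (n_ge1 : (1 <= n)%N)
    (Sigma_posdef : posdef_sym Sigma)
    (X_gaussian : gaussian_vector mu Sigma X)
    (gamma_gt0 : 0 < gamma)
    (theta_gt0 : 0 < theta)
    (domain_neq0 : exists a : 'cV[R]_n, mv_domain gamma Sigma (theta, a)) :
  worst_case_portfolio gamma mu Sigma X theta = nominal_portfolio gamma mu X
  <-> exists m : R, mu = m *: ones.
Proof.
have [a [l [a1 aE]]] :=
  stationary_portfolio_exists mu Sigma Sigma_posdef gamma gamma_gt0 n_ge1.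
have -> : nominal_portfolio gamma mu X = a.
  exact: (nominal_portfolio_stationary _ _ Sigma_posdef _ gamma_gt0 a l a1 aE).
split=> [wcE|[m muE]]; last first.
  exact: (worst_case_portfolio_proportional _ _ Sigma_posdef _ gamma_gt0 a l
    a1 aE X X_gaussian _ theta_gt0 m).
(* [m] is the coefficient of the orthogonal projection of mu on 1. The residual [z] is orthogonal to
   1, hence to Sigma a, hence by stationarity to mu, and so to itself. *)
pose m := dot mu ones / dot ones (ones : 'cV[R]_n).
have o0 : dot ones (ones : 'cV[R]_n) != 0.
  by apply: contra_neq (ones_neq0 R _ n_ge1); exact: dotxx_eq0.
exists m; pose z := mu - m *: ones.
have z1 : dot z ones = 0 by rewrite /z dotBl dotZl /m divfK// subrr.
have zS : dot z (Sigma *m a) = 0.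
  exact: (worst_case_portfolio_orthogonal _ _ Sigma_posdef _ gamma_gt0 a l
    a1 aE X X_gaussian _ theta_gt0 z).
have zmu : dot z mu = 0.
  by have := stationaryE mu Sigma gamma a l aE z; rewrite zS z1 !mulr0 addr0.
apply/eqP; rewrite -subr_eq0 -/z; apply/eqP/dotxx_eq0.
by rewrite {2}/z dotBr zmu dotZr z1 mulr0 subrr.
Qed.
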